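(* Let $G$ be a Dedekind $\sigma$-complete truncated $\ell$-group. Then there exist a set $X$, a $\sigma$-ideal $\mathcal{I}$ of subsets of $X$ and an injective $\sigma$-continuous $\ell$-homomorphism $\iota\colon G\hookrightarrow\frac{\mathbb{R}^X}{\mathcal{I}}$ such that, for every $f\in G$, $\iota(\overline{f})=\iota(f)\land[1]_{\mathcal{I}}$.
   Context: For an abelian $\ell$-group (lattice-ordered group) $G$, $G^+=\{x\in G\mid x\geq0\}$, $f^+=f\lor0$, $f^-=-(f\land0)$, and $\omega=\{0,1,2,\dots\}$. A truncated $\ell$-group is an abelian $\ell$-group $G$ with a unary operation $\overline{\,\cdot\,}\colon G\to G$ such that: (T1) $\overline{f}=\overline{f^+}-f^-$ for all $f\in G$; (T2) $\overline{f}\in G^+$ for all $f\in G^+$; (T3) $f\land\overline{g}\leq\overline{f}\leq f$ for all $f,g\in G^+$; (T4) for $f\in G^+$, $\overline f=0$ implies $f=0$; (T5) for $f\in G^+$, if $nf=\overline{nf}$ for every $n\in\omega$ then $f=0$. (Divisibility is not assumed.) A poset is Dedekind $\sigma$-complete if every nonempty countable subset that has an upper bound has a supremum. A map between posets is $\sigma$-continuous if it preserves all existing suprema of nonempty countable subsets. An $\ell$-homomorphism is a group homomorphism that is a lattice homomorphism. A $\sigma$-ideal of subsets of $X$ is a set $\mathcal{I}$ of subsets of $X$ containing $\emptyset$, closed under taking subsets and under countable unions ($X\in\mathcal{I}$ is allowed). $\frac{\mathbb{R}^X}{\mathcal{I}}$ is the quotient of $\mathbb{R}^X$ by the relation $f\sim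 g$ iff $\{x\in X\mid f(x)\neq g(x)\}\in\mathcal{I}$, with operations (and order) induced from the pointwise ones; $[f]_{\mathcal{I}}$ is the class of $f$, and $[1]_{\mathcal{I}}$ is the class of the constant function $1$. *)

(* Defs.v *)
From HB Require Import structures.
From mathcomp Require Import all_boot all_order all_algebra.
From mathcomp Require Import all_classical reals.

Set Implicit Arguments.
Unset Strict Implicit.
Unset Printing Implicit Defensive.

Import Order.TTheory GRing.Theory Num.Theory.

Local Open Scope classical_set_scope.
Local Open Scope order_scope.
Local Open Scope ring_scope.
Local Open Scope quotient_scope.

(* The library's hierarchy does not admit a new common substructure of
   [Order.Lattice] and [GRing.Zmodule], since [realDomainType] already joins
   them. So the lattice operations are fields here, and the [latticeType]
   structure is then put on the carrier of every [lgroupType]. *)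
HB.mixin Record POrderedZmodule_isLGroup G of Num.POrderedZmodule G := {
  lgroup_meet : G -> G -> G;
  lgroup_join : G -> G -> G;
  lgroup_meetP : forall x y z : G,
    (x <= lgroup_meet y z) = (x <= y) && (x <= z);
  lgroup_joinP : forall x y z : G,
    (lgroup_join x y <= z) = (x <= z) && (y <= z);
  lgroup_leD2l : forall z x y : G, x <= y -> z + x <= z + y
}.

#[short(type="lgroupType")]
HB.structure Definition LGroup :=
  { G of POrderedZmodule_isLGroup G & Num.POrderedZmodule G }.

HB.instance Definition _ (G : lgroupType) :=
  Order.POrder_MeetJoin_isLattice.Build ring_display (LGroup.sort G)
    lgroup_meetP lgroup_joinP.

Definition pos_part (G : lgroupType) (f : G) : G := f `|` 0.
Definition neg_part (G : lgroupType) (f : G) : G := - (f `&` 0).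

(* A truncated l-group is an l-group [G] with [trunc] such that
   [is_truncation trunc]. *)
Record is_truncation (G : lgroupType) (trunc : G -> G) : Prop := IsTruncation {
  truncE : forall f : G, trunc f = trunc (pos_part f) - neg_part f;
  trunc_ge0 : forall f : G, 0 <= f -> 0 <= trunc f;
  trunc_meet_le : forall f g : G, 0 <= f -> 0 <= g ->
    f `&` trunc g <= trunc f /\ trunc f <= f;
  trunc_eq0 : forall f : G, 0 <= f -> trunc f = 0 -> f = 0;
  trunc_archi : forall f : G, 0 <= f ->
    (forall n : nat, f *+ n = trunc (f *+ n)) -> f = 0
}.

(* [has_sup A] is "nonempty and bounded above"; [countable] includes finite. *)
Definition dedekind_sigma_complete d (P : porderType d) : Prop :=
  forall A : set P, countable A -> has_sup A -> supremums A !=set0.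

Definition sigma_continuous d (P : porderType d) d' (Q : porderType d')
    (h : P -> Q) : Prop :=
  forall (A : set P) (s : P), A !=set0 -> countable A ->
    supremums A s -> supremums (h @` A) (h s).

Definition lgroup_morphism (G H : lgroupType) (h : G -> H) : Prop :=
  [/\ {morph h : f g / f + g}, {morph h : f g / f `&` g}
    & {morph h : f g / f `|` g}].

Record sigma_ideal (X : Type) := SigmaIdeal {
  sigma_ideal_set :> set X -> Prop;
  sigma_ideal0 : sigma_ideal_set set0;
  sigma_ideal_sub : forall A B : set X,
    (A `<=` B)%classic -> sigma_ideal_set B -> sigma_ideal_set A;
  sigma_ideal_bigcup : forall F : nat -> set X,
    (forall n, sigma_ideal_set (F n)) -> sigma_ideal_set (\bigcup_n F n)
}.

Section FunctionQuotient.
Variables (X : Type) (R : realType) (I : sigma_ideal X).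
Implicit Types f g h : X -> R.

Lemma sigma_idealU (A B : set X) : I A -> I B -> I (A `|` B)%classic.
Proof.
move=> IA IB; rewrite -bigcup2E; apply: sigma_ideal_bigcup => -[|[|n]] //=.
exact: sigma_ideal0.
Qed.

Lemma sigma_ideal_sub2 (A B C : set X) :
  (forall x, ~ A x -> ~ B x -> ~ C x) -> I A -> I B -> I C.
Proof.
move=> ABC IA IB; apply: sigma_ideal_sub (sigma_idealU IA IB) => x Cx.
by apply: contrapT => /not_orP[/ABC nA /nA].
Qed.

Definition eqmod f g : bool := `[< I [set x | f x <> g x] >].

Lemma eqmod_equiv : equiv_class_of eqmod.
Proof.
split=> [f|f g|g f h].
- apply/asboolP; apply: sigma_ideal_sub (sigma_ideal0 I) => x /=; exact.
- by congr asbool; congr (sigma_ideal_set I _); apply/seteqP; split=> x /= ne e;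
    apply: ne.
- move=> /asboolP fg /asboolP gh; apply/asboolP.
  apply: sigma_ideal_sub2 fg gh => x /= /contrapT -> /contrapT -> //; exact.
Qed.

Canonical eqmod_equivRel := EquivRelPack eqmod_equiv.
Canonical eqmod_encModRel := defaultEncModRel eqmod.

(* The quotient of R^X by I; [\pi_(fquot R I) f] is the class of [f]. *)
Definition fquot := {eq_quot eqmod}.

HB.instance Definition _ := Choice.on fquot.
HB.instance Definition _ : EqQuotient (X -> R) eqmod fquot :=
  EqQuotient.on fquot.

Lemma pi_fquotP f g :
  \pi_fquot f = \pi_fquot g <-> I [set x | f x <> g x].
Proof.
split=> [/eqP|fg]; first by rewrite piE => /asboolP.
by apply/eqP; rewrite piE; apply/asboolP.
Qed.

Definition fquot_zero : fquot := lift_cst fquot (0 : X -> R).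
Definition fquot_add := lift_op2 fquot (fun f g => f + g).
Definition fquot_opp := lift_op1 fquot (fun f => - f).
Definition fquot_meet := lift_op2 fquot (fun f g => f `&` g).
Definition fquot_join := lift_op2 fquot (fun f g => f `|` g).

Definition lemod f g : bool := `[< I [set x | ~ (f x <= g x)] >].
Definition fquot_le := lift_fun2 fquot lemod.

Let morph_lift2 (op : R -> R -> R) (opf : (X -> R) -> (X -> R) -> X -> R) :
  (forall f g x, opf f g x = op (f x) (g x)) ->
  forall f g, \pi_fquot (opf f g) =
    \pi_fquot (opf (repr (\pi_fquot f)) (repr (\pi_fquot g))).
Proof.
move=> opE f g; apply/pi_fquotP.
have /pi_fquotP ff : \pi_fquot f = \pi_fquot (repr (\pi_fquot f)).
  by rewrite reprK.
have /pi_fquotP gg : \pi_fquot g = \pi_fquot (repr (\pi_fquot g)).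
  by rewrite reprK.
apply: sigma_ideal_sub2 ff gg => x /= /contrapT fx /contrapT gx.
by apply; rewrite !opE -fx -gx.
Qed.

Lemma pi_fquot_add : {morph \pi_fquot : f g / f + g >-> fquot_add f g}.
Proof.
by move=> f g; unlock fquot_add; apply: (@morph_lift2 (fun a b => a + b)).
Qed.
Lemma pi_fquot_meet : {morph \pi_fquot : f g / f `&` g >-> fquot_meet f g}.
Proof.
by move=> f g; unlock fquot_meet; apply: (@morph_lift2 (fun a b => a `&` b)).
Qed.
Lemma pi_fquot_join : {morph \pi_fquot : f g / f `|` g >-> fquot_join f g}.
Proof.
by move=> f g; unlock fquot_join; apply: (@morph_lift2 (fun a b => a `|` b)).
Qed.
Lemma pi_fquot_opp : {morph \pi_fquot : f / - f >-> fquot_opp f}.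
Proof.
move=> f; unlock fquot_opp; apply/pi_fquotP.
have /pi_fquotP : \pi_fquot f = \pi_fquot (repr (\pi_fquot f)).
  by rewrite reprK.
apply: sigma_ideal_sub => x /= ne e; apply: ne.
by have -> : (- f) x = - f x by []; rewrite e.
Qed.

Lemma pi_fquot_le : {mono \pi_fquot : f g / lemod f g >-> fquot_le f g}.
Proof.
move=> f g; unlock fquot_le.
have /pi_fquotP ff : \pi_fquot f = \pi_fquot (repr (\pi_fquot f)).
  by rewrite reprK.
have /pi_fquotP gg : \pi_fquot g = \pi_fquot (repr (\pi_fquot g)).
  by rewrite reprK.
have fg := sigma_idealU ff gg.
apply: asbool_equiv_eq; split; move: fg => /[swap]; apply: sigma_ideal_sub2
  => x /= /contrapT le /not_orP[/contrapT fx /contrapT gx]; apply.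
  by rewrite fx gx.
by rewrite -fx -gx.
Qed.

Canonical pi_fquot_zero_morph := PiConst fquot_zero.
Canonical pi_fquot_add_morph := PiMorph2 pi_fquot_add.
Canonical pi_fquot_opp_morph := PiMorph1 pi_fquot_opp.
Canonical pi_fquot_meet_morph := PiMorph2 pi_fquot_meet.
Canonical pi_fquot_join_morph := PiMorph2 pi_fquot_join.
Canonical pi_fquot_le_morph := PiMono2 pi_fquot_le.

Fact fquot_addA : associative fquot_add.
Proof. by elim/quotW=> f; elim/quotW=> g; elim/quotW=> h; rewrite !piE addrA. Qed.
Fact fquot_addC : commutative fquot_add.
Proof. by elim/quotW=> f; elim/quotW=> g; rewrite !piE addrC. Qed.
Fact fquot_add0 : left_id fquot_zero fquot_add.
Proof. by elim/quotW=> f; rewrite !piE add0r. Qed.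
Fact fquot_addN : left_inverse fquot_zero fquot_opp fquot_add.
Proof. by elim/quotW=> f; rewrite !piE addNr. Qed.

HB.instance Definition _ := GRing.isZmodule.Build fquot
  fquot_addA fquot_addC fquot_add0 fquot_addN.

Fact fquot_le_refl : reflexive fquot_le.
Proof.
elim/quotW=> f; rewrite !piE; apply/asboolP.
by apply: sigma_ideal_sub (sigma_ideal0 I) => x /=; rewrite lexx.
Qed.
Fact fquot_le_anti : antisymmetric fquot_le.
Proof.
elim/quotW=> f; elim/quotW=> g; rewrite !piE => /andP[/asboolP fg /asboolP gf].
apply/pi_fquotP; apply: sigma_ideal_sub2 fg gf => x /= /contrapT fg /contrapT gf.
by apply; apply/le_anti; rewrite fg gf.
Qed.
Fact fquot_le_trans : transitive fquot_le.
Proof.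
elim/quotW=> g; elim/quotW=> f; elim/quotW=> h; rewrite !piE.
move=> /asboolP fg /asboolP gh; apply/asboolP.
apply: sigma_ideal_sub2 fg gh => x /= /contrapT fg /contrapT gh.
by apply; apply: le_trans gh.
Qed.

HB.instance Definition _ := Order.Le_isPOrder.Build ring_display fquot
  fquot_le_refl fquot_le_anti fquot_le_trans.

Lemma fquot_leE (a b : fquot) : (a <= b) = fquot_le a b.
Proof. by []. Qed.

Fact fquot_meetP (a b c : fquot) :
  (a <= fquot_meet b c) = (a <= b) && (a <= c).
Proof.
elim/quotW: a => f; elim/quotW: b => g; elim/quotW: c => h.
rewrite !fquot_leE !piE.
apply/idP/andP => [/asboolP fgh|[/asboolP fg /asboolP fh]]; last apply/asboolP.
  split; apply/asboolP; apply: sigma_ideal_sub fgh => x /=; apply: contra_not.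
    by rewrite meetfE lexI => /andP[].
  by rewrite meetfE lexI => /andP[].
apply: sigma_ideal_sub2 fg fh => x /= /contrapT fg /contrapT fh.
by apply; rewrite meetfE lexI fg fh.
Qed.
Fact fquot_joinP (a b c : fquot) :
  (fquot_join a b <= c) = (a <= c) && (b <= c).
Proof.
elim/quotW: a => f; elim/quotW: b => g; elim/quotW: c => h.
rewrite !fquot_leE !piE.
apply/idP/andP => [/asboolP fgh|[/asboolP fh /asboolP gh]]; last apply/asboolP.
  split; apply/asboolP; apply: sigma_ideal_sub fgh => x /=; apply: contra_not.
    by rewrite joinfE leUx => /andP[].
  by rewrite joinfE leUx => /andP[].
apply: sigma_ideal_sub2 fh gh => x /= /contrapT fh /contrapT gh.
by apply; rewrite joinfE leUx fh gh.
Qed.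

HB.instance Definition _ := Order.POrder_MeetJoin_isLattice.Build ring_display
  fquot fquot_meetP fquot_joinP.

Fact fquot_leD2l (c a b : fquot) : a <= b -> c + a <= c + b.
Proof.
elim/quotW: a => f; elim/quotW: b => g; elim/quotW: c => h.
have addE (a b : fquot) : a + b = fquot_add a b by [].
rewrite !fquot_leE !addE !piE => /asboolP fg.
apply/asboolP; apply: sigma_ideal_sub fg => x /=; apply: contra_not.
by rewrite !fctE lerD2l.
Qed.

HB.instance Definition _ := POrderedZmodule_isLGroup.Build fquot
  fquot_meetP fquot_joinP fquot_leD2l.

(* The structure of the quotient is induced by the pointwise one. *)
Lemma pi_fquot0 : \pi_fquot (0 : X -> R) = 0.
Proof. by rewrite -[RHS]/fquot_zero piE. Qed.
Lemma pi_fquotD f g : \pi_fquot (f + g) = \pi_fquot f + \pi_fquot g.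
Proof. exact: pi_fquot_add. Qed.
Lemma pi_fquotN f : \pi_fquot (- f) = - \pi_fquot f.
Proof. exact: pi_fquot_opp. Qed.
Lemma pi_fquotI f g : \pi_fquot (f `&` g) = \pi_fquot f `&` \pi_fquot g.
Proof. exact: pi_fquot_meet. Qed.
Lemma pi_fquotU f g : \pi_fquot (f `|` g) = \pi_fquot f `|` \pi_fquot g.
Proof. exact: pi_fquot_join. Qed.
Lemma pi_fquot_leP f g :
  \pi_fquot f <= \pi_fquot g <-> I [set x | ~ (f x <= g x)].
Proof. by rewrite fquot_leE piE; split=> /asboolP. Qed.

End FunctionQuotient.

Arguments fquot {X} R I.

(* Main.v *)
Require Import Defs.
From mathcomp Require Import all_boot all_order all_algebra.
From mathcomp Require Import all_classical reals.

(** Call a pair [(e, w)] a local unit when [0 < w <= e] and [trunc f] agrees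
    with [f `&` e] on the region where [w] lives.  A point of [X] is a candidate
    unit [e] with a sequence [u] of elements of [G], thought of as shrinking
    regions; the value of [f] there is the supremum of the fractions [p / q] such
    that [p e <= q f] holds on some [u n].  A set of points is negligible when,
    for every local unit [(e, w)], it is avoided by all sequences below [w] that
    meet some suitable countable family of dense sets.  Each instance of
    additivity, of compatibility with meets and truncation, and of preservation
    of a countable supremum is forced by countably many dense sets, hence holds
    off a negligible set, while the Rasiowa-Sikorski argument shows that
    [f > 0] does not vanish almost everywhere.  Dedekind sigma-completeness
    only enters through the Archimedean property. *)

Local Open Scope order_scope.
Local Open Scope ring_scope.
Local Open Scope quotient_scope.

Set Implicit Arguments.
Unset Strict Implicit.
Unset Printing Implicit Defensive.

Import Order.TTheory GRing.Theory Num.Theory.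

(** * Arithmetic of abelian l-groups and nonnegativity on a region *)

Section LGroupTheory.
Variable G : lgroupType.
Implicit Types f g u x y z : G.

Lemma lgroup_lerD2l z x y : (z + x <= z + y) = (x <= y).
Proof.
apply/idP/idP; last exact: lgroup_leD2l.
by move=> /(lgroup_leD2l (- z)); rewrite !addKr.
Qed.

Lemma lgroup_lerD2r z x y : (x + z <= y + z) = (x <= y).
Proof. by rewrite ![_ + z]addrC lgroup_lerD2l. Qed.

Lemma lgroup_lerBlDr x y z : (x - y <= z) = (x <= z + y).
Proof. by rewrite -(lgroup_lerD2r y (x - y)) subrK. Qed.

Lemma lgroup_lerBrDr x y z : (x <= y - z) = (x + z <= y).
Proof. by rewrite -(lgroup_lerD2r z x) subrK. Qed.

Lemma lgroup_subr_ge0 x y : (0 <= y - x) = (x <= y).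
Proof. by rewrite lgroup_lerBrDr add0r. Qed.

Lemma lgroup_lerN2 x y : (- x <= - y) = (y <= x).
Proof. by rewrite -[leLHS]add0r lgroup_lerBlDr addrC lgroup_subr_ge0. Qed.

Lemma lgroup_lerD x y z t : x <= y -> z <= t -> x + z <= y + t.
Proof.
by move=> xy zt; rewrite (@le_trans _ _ (y + z)) ?lgroup_lerD2r ?lgroup_lerD2l.
Qed.

Lemma lgroup_addr_ge0 x y : 0 <= x -> 0 <= y -> 0 <= x + y.
Proof. by move=> x0 y0; rewrite -[0]addr0 lgroup_lerD. Qed.

Lemma lgroup_mulrn_ge0 x n : 0 <= x -> 0 <= x *+ n.
Proof.
by move=> x0; elim: n => [|n IHn]; rewrite ?mulr0n // mulrS lgroup_addr_ge0.
Qed.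

Lemma lgroup_lerMn2r n x y : x <= y -> x *+ n <= y *+ n.
Proof.
by move=> xy; rewrite -lgroup_subr_ge0 -mulrnBl lgroup_mulrn_ge0
  ?lgroup_subr_ge0.
Qed.

Lemma lgroup_lerMz2r x (m n : int) : 0 <= x -> m <= n -> x *~ m <= x *~ n.
Proof.
move=> x0 mn; rewrite -lgroup_subr_ge0 -mulrzBr.
by have := mn; rewrite -subr_ge0; case: (n - m) => // k _;
  rewrite lgroup_mulrn_ge0.
Qed.

Lemma lgroup_lerBlDl x y z : (x - y <= z) = (x <= y + z).
Proof. by rewrite lgroup_lerBlDr addrC. Qed.

Lemma lgroup_lerBrDl x y z : (x <= y - z) = (z + x <= y).
Proof. by rewrite lgroup_lerBrDr addrC. Qed.

Lemma lgroup_addrI x y z : x + (y `&` z) = (x + y) `&` (x + z).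
Proof.
apply/le_anti; rewrite lexI !lgroup_lerD2l leIl leIr /= -lgroup_lerBlDl lexI.
by rewrite !lgroup_lerBlDl leIl leIr.
Qed.

Lemma lgroup_addrU x y z : x + (y `|` z) = (x + y) `|` (x + z).
Proof.
apply/le_anti; rewrite leUx !lgroup_lerD2l leUl leUr !andbT -lgroup_lerBrDl
  leUx.
by rewrite !lgroup_lerBrDl leUl leUr.
Qed.

Lemma lgroup_opprI x y : - (x `&` y) = (- x) `|` (- y).
Proof.
apply/le_anti; rewrite leUx !lgroup_lerN2 leIl leIr /= andbT.
rewrite -[leRHS]opprK lgroup_lerN2 lexI.
by apply/andP; split; rewrite -lgroup_lerN2 opprK ?leUl ?leUr.
Qed.

Lemma lgroup_joinE x y : x `|` y = x + y - (x `&` y).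
Proof. by rewrite lgroup_opprI lgroup_addrU addrK addrAC subrr add0r joinC. Qed.

Lemma neg_partE f : neg_part f = (- f) `|` 0.
Proof. by rewrite /neg_part lgroup_opprI oppr0. Qed.

Lemma neg_part_ge0 f : 0 <= neg_part f.
Proof. by rewrite neg_partE leUr. Qed.

Lemma pos_partE f : pos_part f = f + neg_part f.
Proof. by rewrite neg_partE lgroup_addrU subrr addr0 joinC. Qed.

Lemma neg_partN f : neg_part (- f) = pos_part f.
Proof. by rewrite neg_partE opprK. Qed.

Lemma ge0_neg_part f : 0 <= f -> neg_part f = 0.
Proof. by move=> f0; rewrite neg_partE join_r // -oppr0 lgroup_lerN2. Qed.

Lemma neg_partD f g : neg_part (f + g) <= neg_part f + neg_part g.
Proof.
rewrite neg_partE leUx lgroup_addr_ge0 ?neg_part_ge0 // andbT opprD.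
by rewrite lgroup_lerD // neg_partE leUl.
Qed.

Lemma neg_part_disjoint f : neg_part f `&` neg_part (- f) = 0.
Proof.
rewrite neg_partN pos_partE addrC -{1}[neg_part f]addr0 -lgroup_addrI.
by rewrite /neg_part meetC addNr.
Qed.

(** Subtracting [x] from the meet of [u] and [x + y] leaves an element below both [u] and [y], hence
    at most [0]; so that meet is also below [x]. *)
Lemma disjointD u x y : 0 <= x ->
  u `&` x <= 0 -> u `&` y <= 0 -> u `&` (x + y) <= 0.
Proof.
move=> x0 ux uy; apply: le_trans ux; rewrite lexI leIl -[leRHS]add0r.
rewrite -lgroup_lerBlDr; apply: le_trans uy; rewrite lexI !lgroup_lerBlDr.
rewrite [y + x]addrC leIr andbT (le_trans (leIl _ _)) //.
by rewrite -[leLHS]addr0 lgroup_lerD2l.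
Qed.

Lemma disjointMn u x n : 0 <= x -> u `&` x <= 0 -> u `&` (x *+ n) <= 0.
Proof.
move=> x0 ux; elim: n => [|n IHn]; first by rewrite mulr0n leIr.
by rewrite mulrS disjointD.
Qed.

(** Subtracting their meet from [x] and [y] makes them disjoint, and disjoint positive elements have
    disjoint multiples. *)
Lemma lgroup_mulrnI x y n : (x `&` y) *+ n = (x *+ n) `&` (y *+ n).
Proof.
apply/le_anti; rewrite lexI !lgroup_lerMn2r ?leIl ?leIr //=.
set m := x `&` y.
have mx : 0 <= x - m by rewrite lgroup_subr_ge0 leIl.
have my : 0 <= y - m by rewrite lgroup_subr_ge0 leIr.
have xy0 : (x - m) `&` (y - m) <= 0.
  by rewrite ![_ - m]addrC -lgroup_addrI addNr.
have := disjointMn n my xy0; rewrite meetC => /(disjointMn n mx).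
rewrite !mulrnBl ![_ - m *+ n]addrC -lgroup_addrI -lgroup_lerBrDl.
by rewrite sub0r opprK meetC.
Qed.

(* "[f >= 0] on the region where [u > 0]". *)
Definition nonneg_on u f : Prop := u `&` neg_part f <= 0.

Lemma nonneg_on_ge0 u f : 0 <= f -> nonneg_on u f.
Proof. by move=> f0; rewrite /nonneg_on ge0_neg_part // leIr. Qed.

Lemma nonneg_onS u v f : v <= u -> nonneg_on u f -> nonneg_on v f.
Proof. by move=> vu; apply: le_trans; rewrite leI2. Qed.

Lemma nonneg_onD u f g : nonneg_on u f -> nonneg_on u g -> nonneg_on u (f + g).
Proof.
move=> uf ug; apply: le_trans (disjointD (neg_part_ge0 f) uf ug).
by rewrite leI2 // neg_partD.
Qed.

Lemma nonneg_on_le u f g : f <= g -> nonneg_on u f -> nonneg_on u g.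
Proof.
rewrite -lgroup_subr_ge0 => /(nonneg_on_ge0 u) ugf /nonneg_onD/(_ ugf).
by rewrite addrC subrK.
Qed.

Lemma nonneg_onMn u f n : nonneg_on u f -> nonneg_on u (f *+ n).
Proof.
move=> uf; elim: n => [|n IHn]; first by rewrite mulr0n; apply: nonneg_on_ge0.
by rewrite mulrS; apply: nonneg_onD.
Qed.

(** Shrinking the region settles the sign of [f]: if [neg_part f] meets [u], their meet is a smaller
    region, disjoint from [neg_part (- f)]. *)
Lemma nonneg_on_total u f : 0 < u ->
  nonneg_on u f \/ exists v, [/\ 0 < v, v <= u & nonneg_on v (- f)].
Proof.
move=> u0; case: (pselect (u `&` neg_part f <= 0)) => uf; [by left|right].
exists (u `&` neg_part f); split; rewrite ?leIl //.
  rewrite lt_neqAle lexI (ltW u0) neg_part_ge0 !andbT.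
  by apply/eqP => e; apply: uf; rewrite -e.
by apply: (nonneg_onS (leIr _ _)); rewrite /nonneg_on neg_part_disjoint.
Qed.

(** The negative part of [f] is below [u *+ n] and disjoint from it, hence zero. *)
Lemma nonneg_on_ge u f n : 0 <= u -> nonneg_on u f -> - (u *+ n) <= f -> 0 <= f.
Proof.
move=> u0 uf unf; have fu : neg_part f <= u *+ n.
  by rewrite neg_partE leUx lgroup_mulrn_ge0 // -[u *+ n]opprK lgroup_lerN2 unf.
have : neg_part f `&` (u *+ n) <= 0 by apply: disjointMn; rewrite // meetC.
rewrite meet_l // neg_partE leUx => /andP[+ _].
by rewrite -[X in _ <= X -> _]oppr0 lgroup_lerN2.
Qed.

(** For [m < 0], [u <= e] would place [u] below the negative part of [e *~ m], forcing [u <= 0]. *)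
Lemma nonneg_on_mulz_ge0 u e (m : int) :
  0 < u -> u <= e -> nonneg_on u (e *~ m) -> 0 <= m.
Proof.
move=> u0 ue um; rewrite leNgt; apply/negP => m0.
have e0 : 0 <= e := le_trans (ltW u0) ue.
have := u0; rewrite lt_neqAle => /andP[/eqP + _]; apply; apply/le_anti.
rewrite ltW //=; apply: le_trans um; rewrite lexI lexx neg_partE; apply: lexUl.
have := @lgroup_lerMz2r _ 1 (- m) e0; rewrite mulrNz => /(_ _) le.
by rewrite (le_trans ue) // le // -gtz0_ge1 oppr_gt0.
Qed.

End LGroupTheory.

(** * Archimedean property and approximation of suprema on small regions *)

Section Density.
Variable G : lgroupType.
Hypothesis hG : dedekind_sigma_complete G.
Implicit Types (f u e : G) (A : set G).

(** If [s] is the supremum of the multiples of [x], then [s - x] bounds them too. *)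
Lemma sigma_complete_archi x f : (forall n, x *+ n <= f) -> x <= 0.
Proof.
move=> xf; have [||s [ub lub]] := @hG (range (fun n => x *+ n)).
- exact: sub_countable (card_image_le _ _) (countableP _).
- by split; [exists (x *+ 0), 0%N | exists f => _ [n _ <-]].
suff : s <= s - x by rewrite lgroup_lerBrDr -lgroup_lerBrDl subrr.
apply: lub => _ [n _ <-]; rewrite lgroup_lerBrDr -mulrSr.
by apply: ub; exists n.+1.
Qed.

(** If no smaller region worked, [f - e *+ k] would be nonnegative on [u] for every [k], which
    forces every multiple of [u] below the join of [f] and [0]. *)
Lemma bounded_dense u e f : 0 < u -> u <= e ->
  exists k v, [/\ 0 < v, v <= u & nonneg_on v (e *+ k - f)].
Proof.
move=> u0 ue; apply: contrapT => nbd.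
suff : u <= 0 by move=> /(lt_le_trans u0); rewrite ltxx.
apply: (@sigma_complete_archi _ (f `|` 0)) => k.
have [ufk|[v [v0 vu vk]]] := nonneg_on_total (f - e *+ k) u0; last first.
  by case: nbd; exists k, v; rewrite -[_ - f]opprB.
rewrite -lgroup_subr_ge0; apply: (@nonneg_on_ge _ u _ k); first exact: ltW.
  apply: nonneg_on_le ufk; rewrite lgroup_lerD ?leUl // lgroup_lerN2.
  exact: lgroup_lerMn2r.
by rewrite -[leLHS]add0r lgroup_lerD2r leUr.
Qed.

(* For [m = 1] this is the definition of [s].  Without divisibility one descends
   on [m], for all [c] with [u <= c *+ m] at once: this class is closed under
   meets with the [s - a]. *)
Lemma le_mulrn_inf A s u m : (A !=set0)%classic -> supremums A s ->
  (forall a, A a -> u <= (s - a) *+ m) -> u <= 0.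
Proof.
move=> [a0 Aa0] [ub lub] um.
suff small j : (j <= m)%N ->
    forall c, u <= c *+ m -> u <= c *+ (m - j)%N.
  by have := small m (leqnn m) _ (um _ Aa0); rewrite subnn mulr0n.
elim: j => [|j IHj] jm c uc; first by rewrite subn0.
have mj : (m - j = (m - j.+1).+1)%N by rewrite subnSK.
(* By induction at the meet of [c] and [s - a], the element [u - c *+ (m - j.+1)] is at most [s - a]
   for every [a] in [A], so subtracting it from [s] still gives an upper bound. *)
suff : s <= s - (u - c *+ (m - j.+1)).
  by rewrite lgroup_lerBrDr -lgroup_lerBrDl subrr lgroup_lerBlDr add0r.
apply: lub => a Aa; rewrite lgroup_lerBrDl -lgroup_lerBrDr lgroup_lerBlDl.
have {}/IHj : u <= (c `&` (s - a)) *+ m.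
  by rewrite lgroup_mulrnI lexI uc um.
move=> /(_ (ltnW jm)); rewrite mj mulrSr => /le_trans; apply.
by apply: lgroup_lerD; [apply: lgroup_lerMn2r; exact: leIl | exact: leIr].
Qed.

(** Shrinking could only fail if [u <= (s - a) *+ m] for every [a] in [A], which [le_mulrn_inf]
    excludes. *)
Lemma sup_dense A s u e m : (A !=set0)%classic -> supremums A s -> 0 < u ->
  u <= e ->
  exists a v, [/\ A a, 0 < v, v <= u & nonneg_on v (e - (s - a) *+ m)].
Proof.
move=> A0 As u0 ue; apply: contrapT => nbd.
suff : u <= 0 by move=> /(lt_le_trans u0); rewrite ltxx.
apply: (le_mulrn_inf (m := m) A0 As) => a Aa.
have [usa|[v [v0 vu va]]] := nonneg_on_total ((s - a) *+ m - e) u0; last first.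
  by case: nbd; exists a, v; rewrite -[e - _]opprB.
rewrite -lgroup_subr_ge0; apply: (@nonneg_on_ge _ u _ 1); first exact: ltW.
  by apply: nonneg_on_le usa; rewrite lgroup_lerD2l lgroup_lerN2.
rewrite mulr1n -[leLHS]add0r lgroup_lerD2r lgroup_mulrn_ge0 //.
by rewrite lgroup_subr_ge0; apply As.1.
Qed.

End Density.

(** * Truncation and local units *)

Section Truncation.
Variables (G : lgroupType) (trunc : G -> G).
Hypothesis htrunc : is_truncation trunc.
Implicit Types (e f g h w : G).

Definition local_unit e w :=
  [/\ 0 < w, w <= e, forall f, f `&` e <= trunc f
    & forall f, nonneg_on w (f `&` e - trunc f)].

Lemma trunc_le f : 0 <= f -> trunc f <= f.
Proof. by move=> f0; case: (trunc_meet_le htrunc f0 f0). Qed.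

Lemma trunc_meetl f g : 0 <= f -> 0 <= g -> f `&` trunc g <= trunc f.
Proof. by move=> f0 g0; case: (trunc_meet_le htrunc f0 g0). Qed.

Lemma pos_part_ge0 f : 0 <= pos_part f. Proof. exact: leUr. Qed.

(** The analogue of [truncE] for the meet with [e]: comparing that meet with [trunc] reduces to
    positive elements. *)
Lemma meet_pos_part f e : 0 <= e -> f `&` e = pos_part f `&` e - neg_part f.
Proof.
move=> e0; apply/le_anti/andP; split.
  rewrite lgroup_lerBrDr lexI pos_partE lgroup_lerD2r leIl /=.
  rewrite neg_partE lgroup_addrU addr0 leUx leIr andbT.
  by rewrite lgroup_lerBlDr (le_trans (leIl _ _)) // -[leLHS]add0r
    lgroup_lerD2r.
rewrite lexI lgroup_lerBlDr -pos_partE leIl /= lgroup_lerBlDr.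
by rewrite (le_trans (leIr _ _)) // -[leLHS]addr0 lgroup_lerD2l neg_part_ge0.
Qed.

(* By (T5) some [n h] exceeds its truncation [e]; where it does, [e] plays the
   role of the constant [1]. *)
Lemma exists_local_unit h : 0 < h ->
  exists e w n, local_unit e w /\ e <= h *+ n.+1.
Proof.
move=> h0; have [n nh] : exists n, h *+ n <> trunc (h *+ n).
  apply: contrapT => /forallNP nh;
    suff h_eq0 : h = 0 by rewrite h_eq0 ltxx in h0.
  by apply: (trunc_archi htrunc (ltW h0)) => n; apply: contrapT; exact: nh.
have H0 : 0 <= h *+ n by rewrite lgroup_mulrn_ge0 // ltW.
set H := h *+ n in nh H0; set e := trunc H.
have e0 : 0 <= e by apply: trunc_ge0.
have eH : e <= H by apply: trunc_le.
have He0 : 0 <= H - e by rewrite lgroup_subr_ge0.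
exists e, ((H - e) `&` e), n; split; last first.
  by rewrite (le_trans eH) // mulrSr -[leLHS]addr0 lgroup_lerD2l ltW.
have meetE f : f `&` e <= trunc f.
  rewrite (truncE htrunc) meet_pos_part // lgroup_lerD2r.
  exact: trunc_meetl (pos_part_ge0 _) H0.
split=> //.
(* If the meet of [H - e] and [e] were zero, [trunc (H - e)], which lies below both, would vanish,
   and [trunc_eq0] would give [H = trunc H]. *)
- rewrite lt_neqAle lexI He0 e0 !andbT; apply/eqP => we0.
  have tw0 : trunc (H - e) = 0.
    apply/le_anti; rewrite (trunc_ge0 htrunc) // andbT [leRHS]we0.
    rewrite lexI trunc_le //=; have := trunc_meetl H0 He0.
    rewrite meet_r // (le_trans (trunc_le He0)) // lgroup_lerBlDr.
    by rewrite -[leLHS]addr0 lgroup_lerD2l.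
  have /eqP := trunc_eq0 htrunc He0 tw0.
  by rewrite subr_eq0 => /eqP.
- exact: leIr.
move=> f; rewrite (truncE htrunc) (meet_pos_part f) //.
set g := pos_part f; have g0 : 0 <= g by apply: pos_part_ge0.
rewrite opprB subrKA /nonneg_on neg_partE opprB.
set t := trunc g; have tg : t <= g by apply: trunc_le.
have tH : t `&` H <= e by rewrite meetC; apply: trunc_meetl.
(* [H - e] and the negative part to be tested lie below the two members of this meet, since the meet
   of [t] and [H] is below both [e] and [g]. *)
have meet0 : (H - t `&` H) `&` (t - t `&` H) = 0.
  by rewrite ![_ - t `&` H]addrC -lgroup_addrI [H `&` t]meetC addNr.
rewrite -[leRHS]meet0; apply: leI2.
  by rewrite (le_trans (leIl _ _)) // lgroup_lerD2l lgroup_lerN2.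
rewrite leUx lgroup_subr_ge0 leIl andbT lgroup_lerD2l lgroup_lerN2.
by rewrite lexI tH (le_trans (leIl _ _)).
Qed.

End Truncation.

(** * Forcing with positive elements: descending sequences and countably many dense sets *)

Section Generic.
Variable G : lgroupType.
Implicit Types (v w : G) (D : set G) (P Q : set (nat -> G)).

Definition dense_below w D :=
  forall u : G, 0 < u -> u <= w -> exists v, [/\ 0 < v, v <= u & D v].

Definition descending w (u : nat -> G) :=
  [/\ forall n, 0 < u n, forall n, u n.+1 <= u n & u 0 <= w].

Definition generically w P := exists Ds : set (set G),
  [/\ countable Ds, forall D, Ds D -> dense_below w D
    & forall u, descending w u ->
        (forall D, Ds D -> exists n, D (u n)) -> P u].

Lemma descending_le w u m n : descending w u -> (m <= n)%N -> u n <= u m.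
Proof.
move=> [_ uS _]; elim: n => [|n IHn]; first by rewrite leqn0 => /eqP ->.
by rewrite leq_eqVlt => /predU1P[-> //|/IHn]; apply: le_trans.
Qed.

Lemma generically_sub w P Q : (P `<=` Q)%classic -> generically w P ->
  generically w Q.
Proof. by move=> PQ [Ds [cD dD DP]]; exists Ds;
  split=> // u wu /(DP u wu)/PQ. Qed.

Lemma generically_meets w D : dense_below w D ->
  generically w [set u | exists n, D (u n)]%classic.
Proof.
move=> dD; exists [set D]%classic; split=> [|_ -> //|u _];
  first exact: countable1.
exact.
Qed.

Lemma generically_descending w : generically w (descending w).
Proof. by exists set0; split=> //; exact: countable0. Qed.

(** Countably many countable families of dense sets unite into a countable one; this is what closes
    negligible sets under countable unions. *)
Lemma generically_forall w (T : Type) (A : set T) (P : T -> set (nat -> G)) :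
  countable A -> (forall a, A a -> generically w (P a)) ->
  generically w [set u | forall a, A a -> P a u]%classic.
Proof.
move=> cA AP.
have /choice[Ds DsP] : forall a, exists Ds : set (set G), A a ->
    [/\ countable Ds, forall D, Ds D -> dense_below w D
    & forall u, descending w u ->
        (forall D, Ds D -> exists n, D (u n)) -> P a u].
  move=> a; case: (pselect (A a)) => [/AP[Ds DsP]|nA]; first by exists Ds.
  by exists set0.
exists (\bigcup_(a in A) Ds a)%classic; split.
- by apply: bigcup_countable => // a /DsP[].
- by move=> D [a /DsP[_ dD _]]; apply: dD.
- move=> u wu uD a Aa; have [_ _] := DsP a Aa; apply=> // D DsD.
  by apply: uD; exists a.
Qed.

Lemma generically_and w P Q :
  generically w P -> generically w Q -> generically w (P `&` Q)%classic.
Proof.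
move=> gP gQ; have := @generically_forall w bool setT (fun b => if b then P
  else Q).
move=> /(_ (countableP _));
  have H b : setT b -> generically w (if b then P else Q).
  by case: b.
move=> /(_ H); apply: generically_sub => u uPQ.
by split; [exact: (uPQ true) | exact: (uPQ false)].
Qed.

(* Rasiowa-Sikorski: meet the countably many dense sets one after another. *)
Lemma generically_ex w P : 0 < w -> generically w P ->
  exists2 u, descending w u & P u.
Proof.
move=> w0 [Ds [/countable_injP[idx idx_inj] dD DP]].
have /choice[step stepP] : forall x : nat * G, exists v,
    0 < x.2 -> x.2 <= w -> [/\ 0 < v, v <= x.2
      & forall D, Ds D -> idx D = x.1 -> D v].
  move=> [n u] /=.
  case: (pselect (0 < u /\ u <= w)) => [[u0 uw]|nu]; last first.
    by exists u => u0 uw; case: nu.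
  case: (pselect (exists2 D, Ds D & idx D = n)) => [[D DsD Dn]|nD]; last first.
    by exists u; split=> // D DsD Dn; case: nD; exists D.
  have [v [v0 vu Dv]] := dD D DsD u u0 uw; exists v => _ _;
    split=> // D' DsD' D'n.
  by have -> // : D' = D; apply: idx_inj; rewrite ?inE // Dn.
pose u := fix u n := if n is m.+1 then step (m, u m) else w.
have uP n : 0 < u n /\ u n <= w.
  elim: n => [|n [u0 uw]] //=; have [v0 vu _] := stepP (n, u n) u0 uw.
  by split=> //; apply: le_trans uw.
have wu : descending w u.
  split=> [n|n|]; [by case: (uP n) | | by []].
  by have [u0 uw] := uP n; have [_] := stepP (n, u n) u0 uw.
(* The set numbered [n] is met on passing from [u n] to [u n.+1], hence the successor. *)
exists u => //; apply: DP => // D DsD; exists (idx D).+1.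
by have [u0 uw] := uP (idx D); have [_ _] := stepP (idx D, u (idx D)) u0 uw;
  apply.
Qed.

End Generic.

(** * Real values of elements of [G] at a point *)

Section Value.
Variables (R : realType) (G : lgroupType).
Implicit Types (u : nat -> G) (e f g : G).

Definition eventually_nonneg u f := exists n, nonneg_on (u n) f.

(** Clearing denominators keeps each comparison inside [G], which need not be divisible. *)
Definition lower_cut e u f : set R := [set r | exists (p : int) (q : nat),
  r = p%:~R / q.+1%:R /\ eventually_nonneg u (f *+ q.+1 - e *~ p)]%classic.

Definition point_value e u f : R := sup (lower_cut e u f).

(** For sequences descending below [e], these bounds make the lower cut nonempty and bounded above,
    so that [sup] is not a default value. *)
Definition eventually_bounded e u f :=
  (exists k, eventually_nonneg u (e *+ k - f)) /\
  (exists k, eventually_nonneg u (e *+ k + f)).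

Definition eventually_decided e u f := forall (p : int) (q : nat),
  eventually_nonneg u (f *+ q.+1 - e *~ p) \/
  eventually_nonneg u (e *~ p - f *+ q.+1).

Lemma exists_fraction (a b : R) : a < b ->
  exists (p : int) (q : nat), a < p%:~R / q.+1%:R < b.
Proof.
move=> /rat_in_itvoo[r]; rewrite in_itv /= => rab.
exists (numq r), `|denq r|.-1%N; rewrite prednK ?absz_gt0 ?denq_neq0 //.
by rewrite -[_%:R]/(_%:Z%:~R) absz_denq.
Qed.

Variables (e w : G) (u : nat -> G).
Hypotheses (we : w <= e) (wu : descending w u).

Local Notation ev := (eventually_nonneg u).
Local Notation value := (point_value e u).
Local Notation bounded_at := (eventually_bounded e u).
Local Notation decided_at := (eventually_decided e u).

Lemma ev_ge0 f : 0 <= f -> ev f.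
Proof. by move=> f0; exists 0%N; apply: nonneg_on_ge0. Qed.

Lemma evD f g : ev f -> ev g -> ev (f + g).
Proof.
move=> [m mf] [n ng]; exists (maxn m n); apply: nonneg_onD.
  by apply: nonneg_onS mf; apply: descending_le wu _; rewrite leq_maxl.
by apply: nonneg_onS ng; apply: descending_le wu _; rewrite leq_maxr.
Qed.

Lemma evMn f n : ev f -> ev (f *+ n).
Proof. by move=> [m mf]; exists m; apply: nonneg_onMn. Qed.

Lemma ev_mulz_ge0 (m : int) : ev (e *~ m) -> 0 <= m.
Proof.
have [u_gt0 _ u0w] := wu.
move=> [n]; apply: nonneg_on_mulz_ge0; first exact: u_gt0.
exact: le_trans (descending_le wu (leq0n n)) (le_trans u0w we).
Qed.

(** After cross-multiplication the two hypotheses add up to an integer multiple of [e], and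
    [ev_mulz_ge0] makes that integer nonnegative. *)
Lemma ev_cut_le f (p p' : int) (q q' : nat) :
  ev (f *+ q.+1 - e *~ p) -> ev (e *~ p' - f *+ q'.+1) ->
  p%:~R / q.+1%:R <= p'%:~R / q'.+1%:R :> R.
Proof.
move=> /(evMn q'.+1) fp /(evMn q.+1)/(evD fp).
have -> : (f *+ q.+1 - e *~ p) *+ q'.+1 + (e *~ p' - f *+ q'.+1) *+ q.+1 =
    e *~ (p' * q.+1%:Z - p * q'.+1%:Z).
  rewrite mulrzBr !mulrzA -!pmulrn !mulrnBl -!mulrnA addrC.
  by rewrite [(q.+1 * _)%N]mulnC subrKA.
move=> /ev_mulz_ge0; rewrite subr_ge0 => pq.
rewrite ler_pdivrMr ?ltr0n // mulrAC ler_pdivlMr ?ltr0n //.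
by rewrite -[_%:R]/(_%:Z%:~R) -[q.+1%:R]/(q.+1%:Z%:~R) -!intrM ler_int.
Qed.

Lemma lower_cut_neq0 f : bounded_at f -> (lower_cut e u f !=set0)%classic.
Proof.
move=> [_ [k kf]]; exists ((- k%:Z)%:~R / 1%:R), (- k%:Z), 0%N; split => //.
by rewrite mulr1n mulrNz opprK addrC.
Qed.

Lemma lower_cut_ub f : bounded_at f -> has_ubound (lower_cut e u f).
Proof.
move=> [[k kf] _]; exists (k%:Z%:~R / 1%:R) => _ [p [q [-> pf]]].
by apply: (ev_cut_le (q' := 0%N) pf); rewrite mulr1n.
Qed.

Lemma value_ge f (p : int) (q : nat) : bounded_at f ->
  ev (f *+ q.+1 - e *~ p) -> p%:~R / q.+1%:R <= value f.
Proof.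
move=> bf pf; apply: ub_le_sup; first exact: lower_cut_ub.
by exists p, q.
Qed.

Lemma value_le f (p : int) (q : nat) : bounded_at f ->
  ev (e *~ p - f *+ q.+1) -> value f <= p%:~R / q.+1%:R.
Proof.
move=> bf pf; apply: ge_sup; first exact: lower_cut_neq0.
by move=> _ [p' [q' [-> pf']]]; apply: ev_cut_le pf.
Qed.

Lemma value_mono f g : bounded_at f -> bounded_at g -> ev (g - f) ->
  value f <= value g.
Proof.
move=> bf bg fg; apply: ge_sup; first exact: lower_cut_neq0.
move=> _ [p [q [-> pf]]]; apply: value_ge => //.
have := evD (evMn q.+1 fg) pf.
by rewrite mulrnBl subrKA.
Qed.

Lemma bounded_atD f g : bounded_at f -> bounded_at g -> bounded_at (f + g).
Proof.
move=> [[k fk] [k' fk']] [[l gl] [l' gl']]; split.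
  by exists (k + l)%N; have := evD fk gl; rewrite addrACA -mulrnDr opprD.
by exists (k' + l')%N; have := evD fk' gl'; rewrite addrACA -mulrnDr.
Qed.

Lemma bounded_atN f : bounded_at f -> bounded_at (- f).
Proof.
move=> [[k fk] [k' fk']]; split; first by exists k'; rewrite opprK.
by exists k.
Qed.

(** Fractions from the two lower cuts add up, over a common denominator, to one in the cut of the
    sum. *)
Lemma value_superadditive f g : bounded_at f -> bounded_at g ->
  value f + value g <= value (f + g).
Proof.
move=> bf bg; have bfg := bounded_atD bf bg.
rewrite -lerBrDr; apply: ge_sup; first exact: lower_cut_neq0.
move=> r rf; rewrite lerBrDl -lerBrDr; apply: ge_sup.
  exact: lower_cut_neq0.
move=> _ [p' [q' [-> pg]]]; have [p [q [-> pf]]] := rf; rewrite lerBrDr addrC.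
have -> : p%:~R / q.+1%:R + p'%:~R / q'.+1%:R =
    (p * q'.+1%:Z + p' * q.+1%:Z)%:~R / (q.+1 * q'.+1)%N%:R :> R.
  by rewrite addf_div ?pnatr_eq0 // natrM intrD !intrM.
rewrite -[(q.+1 * q'.+1)%N]prednK ?muln_gt0 //; apply: value_ge => //.
rewrite prednK ?muln_gt0 //.
have := evD (evMn q'.+1 pf) (evMn q.+1 pg).
rewrite !mulrnBl -!mulrnA addrACA -opprD [(q'.+1 * _)%N]mulnC -mulrnDl.
by rewrite mulrzDr !mulrzA -!pmulrn.
Qed.

Lemma value_unit (m : int) : value (e *~ m) = m%:~R.
Proof.
have bm : bounded_at (e *~ m).
  have [u_gt0 _ u0w] := wu.
  have e0 : 0 <= e := le_trans (ltW (u_gt0 0%N)) (le_trans u0w we).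
  split; exists `|m|%N; apply: ev_ge0; rewrite pmulrn abszE.
    by rewrite lgroup_subr_ge0 lgroup_lerMz2r // ler_norm.
  rewrite -[e *~ m]opprK -mulrNz lgroup_subr_ge0 lgroup_lerMz2r //.
  by rewrite -normrN ler_norm.
apply/le_anti/andP; split.
  rewrite -[leRHS]divr1; apply: (value_le (q := 0)) => //.
  by rewrite mulr1n subrr; apply: ev_ge0.
rewrite -[leLHS]divr1; apply: (value_ge (q := 0)) => //.
by rewrite mulr1n subrr; apply: ev_ge0.
Qed.

(** One inequality is superadditivity and [value 0 = 0]. If the other failed, a fraction would lie
    strictly between the two sides, and [decided_at] contradicts this either way. *)
Lemma valueN f : bounded_at f -> decided_at f -> value (- f) = - value f.
Proof.
move=> bf df; have bNf := bounded_atN bf; apply/le_anti/andP; split.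
  rewrite -subr_ge0 -opprD oppr_ge0.
  apply: le_trans (value_superadditive bf bNf) _.
  by have := value_unit 0; rewrite mulr0z subrr => ->.
rewrite leNgt; apply/negP => /exists_fraction[p [q /andP[pf fp]]].
have [fq|fq] := df (- p) q; last first.
  have : p%:~R / q.+1%:R <= value (- f).
    by apply: value_ge => //; move: fq; rewrite mulNrn mulrNz addrC.
  by rewrite leNgt pf.
have := value_ge bf fq; rewrite mulrNz mulNr => pf'.
by move: fp; rewrite ltrNr ltNge pf'.
Qed.

Definition regular f := bounded_at f /\ decided_at f.

(** The reverse inequality is superadditivity for [f + g] and [- g]. *)
Lemma valueD f g : regular f -> regular g -> value (f + g) = value f + value g.
Proof.
move=> [bf _] [bg dg]; apply/le_anti; rewrite value_superadditive // andbT.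
have := value_superadditive (bounded_atD bf bg) (bounded_atN bg).
by rewrite addrK valueN // lerBlDr.
Qed.

(** Comparing [f - g] with the fraction [0] tells which of [f] and [g] is eventually the smaller;
    the meet eventually dominates that one. *)
Lemma value_meet f g : regular f -> regular g -> regular (f - g) ->
  regular (f `&` g) -> value (f `&` g) = Num.min (value f) (value g).
Proof.
move=> [bf _] [bg _] [_ /(_ 0 0)]; rewrite mulr1n mulr0z subr0 sub0r opprB.
move=> fg [bm _]; have meet_le h : f `&` g <= h -> bounded_at h ->
    value (f `&` g) <= value h.
  by move=> mh bh; apply: value_mono => //; apply: ev_ge0;
    rewrite lgroup_subr_ge0.
apply/le_anti; rewrite le_min !meet_le ?leIl ?leIr //= ge_min.
have ev_meet x y : ev (y - x) -> ev (x `&` y - x).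
  move=> [n nyx]; exists n; rewrite addrC lgroup_addrI addNr [- x + y]addrC.
  apply: le_trans nyx; apply: leI2; rewrite // !neg_partE lgroup_opprI oppr0.
  by rewrite !leUx leUl leUr.
apply/orP; case: fg => [gf|fg].
  by right; apply: value_mono; rewrite // meetC; apply: ev_meet.
by left; apply: value_mono => //; apply: ev_meet.
Qed.

(** If [r] were smaller by more than [1 / k.+1], an [a] with [(s - a) *+ k.+1] eventually below [e]
    would have a value within [1 / k.+1] of that of [s]. *)
Lemma value_sup (A : set G) s (r : R) : regular s ->
  (forall a, A a -> regular a) ->
  (forall n, exists a, A a /\ ev (e - (s - a) *+ n)) ->
  (forall a, A a -> value a <= r) -> value s <= r.
Proof.
move=> rs rA approx Ar; rewrite leNgt; apply/negP => /ltr_add_invr[k].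
have [a [Aa sa]] := approx k.+1; apply/negP; rewrite -leNgt.
have [[bs _] [ba da]] := (rs, rA a Aa).
rewrite -lerBlDl (le_trans (lerB (lexx _) (Ar a Aa))) // -valueN //.
apply: le_trans (value_superadditive bs (bounded_atN ba)) _.
rewrite -div1r; apply: (value_le (p := 1)) => //.
exact: bounded_atD (bounded_atN _).
Qed.

End Value.

(** * Regularity and approximation along generic sequences *)

Section GenericValue.
Variable G : lgroupType.
Hypothesis hG : dedekind_sigma_complete G.
Implicit Types (e w f s : G) (A : set G).

(** Regularity amounts to two bounds and one sign dichotomy for each pair [(p, q)], hence to
    countably many dense sets. *)
Lemma generically_regular e w f : w <= e ->
  generically w [set u | regular e u f]%classic.
Proof.
move=> we; have bd g : generically w
    [set u | exists k, eventually_nonneg u (e *+ k - g)]%classic.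
  have /generically_meets : dense_below w
      [set v | exists k, nonneg_on v (e *+ k - g)]%classic.
    move=> x x0 xw; have [k [v [v0 vx vk]]] := bounded_dense hG g x0 (le_trans
      xw we).
    by exists v; split=> //; exists k.
  by apply: generically_sub => u [n [k nk]]; exists k, n.
apply: generically_and.
  apply: generically_and; [exact: bd | have := bd (- f)].
  by apply: generically_sub => u [k]; rewrite opprK => uk; exists k.
have dec g : generically w
    [set u | eventually_nonneg u g \/ eventually_nonneg u (- g)]%classic.
  have /generically_meets : dense_below w
      [set v | nonneg_on v g \/ nonneg_on v (- g)]%classic.
    move=> x x0 xw; have [xg|[v [v0 vx vg]]] := nonneg_on_total g x0.
      by exists x; split=> //; left.
    by exists v; split=> //; right.
  by apply: generically_sub => u [n [ng|ng]]; [left|right]; exists n.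
have := @generically_forall _ w _ setT (fun x : int * nat => _) (countableP _)
  (fun x _ => dec (f *+ x.2.+1 - e *~ x.1)).
apply: generically_sub => u ud p q; rewrite -[e *~ p - _]opprB.
exact: (ud (p, q)).
Qed.

Lemma generically_sup e w A s : w <= e -> (A !=set0)%classic -> supremums A s ->
  generically w [set u | forall n, exists a, A a /\
    eventually_nonneg u (e - (s - a) *+ n)]%classic.
Proof.
move=> we A0 As; have sup n : generically w [set u | exists a, A a /\
    eventually_nonneg u (e - (s - a) *+ n)]%classic.
  have /generically_meets : dense_below w
      [set v | exists a, A a /\ nonneg_on v (e - (s - a) *+ n)]%classic.
    move=> x x0 xw.
    have [a [v [Aa v0 vx va]]] := sup_dense n A0 As x0 (le_trans xw we).
    by exists v; split=> //; exists a.
  by apply: generically_sub => u [k [a [Aa ka]]]; exists a; split=> //;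
    exists k.
have := @generically_forall _ w _ setT _ (countableP _) (fun n _ => sup n).
by apply: generically_sub => u us n; apply: us.
Qed.

End GenericValue.

(** * The sigma-ideal and the representation *)

Section Representation.
Variables (R : realType) (G : lgroupType) (trunc : G -> G).
Hypotheses (htrunc : is_truncation trunc) (hG : dedekind_sigma_complete G).
Implicit Types (e f g w : G).

Definition negligible (N : set (G * (nat -> G))) : Prop :=
  forall e w, local_unit trunc e w ->
    generically w [set u | ~ N (e, u)]%classic.

Lemma negligible0 : negligible set0.
Proof.
by move=> e w _; apply: generically_sub (@generically_descending _ w) => u _ [].
Qed.

Lemma negligible_sub A B : (A `<=` B)%classic -> negligible B -> negligible A.
Proof.
move=> AB nB e w ew; apply: generically_sub (nB e w ew) => u.
exact/contra_not/AB.
Qed.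

Lemma negligible_bigcup (F : nat -> set (G * (nat -> G))) :
  (forall n, negligible (F n)) -> negligible (\bigcup_n F n)%classic.
Proof.
move=> nF e w ew; have := @generically_forall _ w _ setT _ (countableP _)
  (fun n _ => nF n e w ew).
by apply: generically_sub => u uF [n _]; apply: uF.
Qed.

Definition negligible_ideal :=
  SigmaIdeal negligible0 negligible_sub negligible_bigcup.

(** Scheme for almost-everywhere statements: find a generic property [P] under which the pointwise
    statement holds. *)
Lemma negligibleI (P : set (G * (nat -> G))) (N : set (G * (nat -> G))) :
  (forall e w, local_unit trunc e w ->
    generically w [set u | P (e, u)]%classic) ->
  (forall e w u, local_unit trunc e w -> descending w u -> P (e, u) ->
    ~ N (e, u)) ->
  negligible_ideal N.
Proof.
move=> gP PN e w ew.
have := generically_and (@generically_descending _ w) (gP e w ew).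
by apply: generically_sub => u [wu Pu]; apply: PN ew wu Pu.
Qed.

Definition regulars (s : seq G) : set (G * (nat -> G)) :=
  [set x | forall f, f \in s -> regular x.1 x.2 f]%classic.

Lemma generically_regulars (s : seq G) e w : local_unit trunc e w ->
  generically w [set u | regulars s (e, u)]%classic.
Proof.
move=> [_ we _ _]; elim: s => [|f s IHs].
  exact: generically_sub (@generically_descending _ w).
have := generically_and (generically_regular hG f we) IHs.
by apply: generically_sub => u [uf us] g; rewrite inE => /predU1P[->|/us].
Qed.

Definition value_at f (x : G * (nat -> G)) : R := point_value R x.1 x.2 f.

Definition representation f : fquot R negligible_ideal :=
  \pi_(fquot R negligible_ideal) (value_at f).

Lemma representationD f g :
  representation (f + g) = representation f + representation g.
Proof.
rewrite -pi_fquotD; apply/pi_fquotP.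
apply: (negligibleI (generically_regulars [:: f; g])) => e w u [_ we _ _] wu ru.
by apply; apply: (valueD _ we wu); apply: ru; rewrite !inE eqxx ?orbT.
Qed.

Lemma representationI f g :
  representation (f `&` g) = representation f `&` representation g.
Proof.
rewrite -pi_fquotI; apply/pi_fquotP.
apply: (negligibleI (generically_regulars [:: f; g; f - g; f `&` g])).
move=> e w u [_ we _ _] wu ru; apply; rewrite meetfE meetEtotal.
by apply: (value_meet _ we wu); apply: ru; rewrite !inE eqxx ?orbT.
Qed.

(** The join is expressed through sums and meets, which are already preserved. *)
Lemma representationU f g :
  representation (f `|` g) = representation f `|` representation g.
Proof.
rewrite [RHS]lgroup_joinE -representationI -!representationD.
by apply/eqP; rewrite eq_sym subr_eq -representationD lgroup_joinE subrK.
Qed.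

Lemma representation_mono f g : f <= g -> representation f <= representation g.
Proof. by move=> /meet_idPl <-; rewrite representationI leIr. Qed.

(** At a point with unit [e] the value of [e] is [1], so the meet with [1] there is the meet with
    [e], which a local unit identifies with [trunc f] on the region [w]. *)
Lemma representation_trunc f : representation (trunc f) =
  representation f `&` \pi_(fquot R negligible_ideal) (cst 1 : _ -> R).
Proof.
rewrite -pi_fquotI; apply/pi_fquotP.
(* The unit varies with the point, so the list of elements required to be regular depends on
   [x.1]. *)
pose P := [set x : G * (nat -> G) |
  regulars [:: f; x.1; f - x.1; (f `&` x.1)%O; trunc f] x]%classic.
apply: (negligibleI (P := P)) => [e w ew|].
  exact: (generically_regulars [:: f; e; f - e; f `&` e; trunc f] ew).
move=> e w u [_ we fe_le fe_ge] wu ru; apply.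
have [rf re rfe rm rt] : [/\ regular e u f, regular e u e, regular e u (f - e),
    regular e u (f `&` e) & regular e u (trunc f)].
  by split; apply: ru; rewrite !inE eqxx ?orbT.
rewrite meetfE meetEtotal /value_at /=.
have <- : point_value R e u e = 1 by have := value_unit R we wu 1;
  rewrite mulr1z.
rewrite -(value_meet _ we wu) //; apply/le_anti/andP; split.
  apply: (value_mono _ we wu rt.1 rm.1); exists 0%N.
  by apply: nonneg_onS (fe_ge f); case: wu.
apply: (value_mono _ we wu rm.1 rt.1); exists 0%N; apply: nonneg_on_ge0.
by rewrite lgroup_subr_ge0.
Qed.

(** For each [a] the bound by [c] holds almost everywhere; since [A] is countable, all these bounds
    hold at once at generic points, where [value_sup] applies. *)
Lemma representation_sigma_continuous : sigma_continuous representation.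
Proof.
move=> A s A0 cA As; split=> [_ [a Aa <-]|].
  by apply: representation_mono; apply: As.1.
elim/quotW=> c Ac; apply/pi_fquot_leP.
pose P := [set x : G * (nat -> G) | [/\ regular x.1 x.2 s,
  forall a, A a -> regular x.1 x.2 a /\ value_at a x <= c x
  & forall n, exists a, A a /\
      eventually_nonneg x.2 (x.1 - (s - a) *+ n)]]%classic.
apply: (negligibleI (P := P)) => [e w ew|e w u [_ we _ _] wu [/= us uA approx]].
  have [_ we _ _] := ew.
  have gA a : A a -> generically w
      [set u | regular e u a /\ value_at a (e, u) <= c (e, u)]%classic.
    move=> Aa; apply: generically_and; first exact: generically_regular.
    have /pi_fquot_leP/(_ _ _ ew) : representation a <= \pi_(fquot R
      negligible_ideal) c.
      by apply: Ac; exists a.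
    by apply: generically_sub => u /contrapT.
  have := generically_and (generically_and (generically_regular hG s we)
    (generically_forall cA gA)) (generically_sup we A0 As).
  by apply: generically_sub => u [[us uA] uapp]; split.
apply; apply: (value_sup we wu us) approx _ => a Aa; by case: (uA a Aa).
Qed.

(** A local unit with [e <= f *+ n.+1] gives [f] a value of at least [1 / n.+1] at regular points;
    [generically_ex] produces such a point where the value would also be [0]. *)
Lemma representation_gt0 f : 0 < f -> representation f <> 0.
Proof.
move=> f0; rewrite -pi_fquot0 => /pi_fquotP nf.
have [e [w [n [ew efn]]]] := exists_local_unit htrunc f0.
have [w0 we _ _] := ew.
have [u wu [uf /contrapT uf0]] :=
  generically_ex w0 (generically_and (generically_regular hG f we) (nf e w ew)).
have : 1%:~R / n.+1%:R <= point_value R e u f.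
  apply: (value_ge _ we wu uf.1); exists 0%N; apply: nonneg_on_ge0.
  by rewrite lgroup_subr_ge0 mulr1z.
by rewrite [point_value R e u f]uf0 leNgt divr_gt0 ?ltr0n.
Qed.

(** If [f] and [g] have the same image, the nonnegative difference between their join and [g] is
    sent to [0], hence is zero, and [f <= g]. *)
Lemma representation_inj : injective representation.
Proof.
have le f g : representation f = representation g -> f <= g.
  move=> fg; have : ~ (0 < (f `|` g) - g).
    move=> /representation_gt0; apply; apply: (addIr (representation g)).
    by rewrite -representationD subrK representationU fg joinxx add0r.
  rewrite lt_neqAle lgroup_subr_ge0 leUr andbT => /negP/negPn.
  by rewrite eq_sym subr_eq0 => /eqP <-; exact: leUl.
by move=> f g fg; apply/le_anti; rewrite !le.
Qed.

End Representation.

Theorem theorem9p2 (R : realType) (G : lgroupType) (trunc : G -> G)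
    (htrunc : is_truncation trunc) (hG : dedekind_sigma_complete G) :
  exists (X : Type) (I : sigma_ideal X) (iota : G -> fquot R I),
    [/\ injective iota, sigma_continuous iota, lgroup_morphism iota
      & forall f : G,
          iota (trunc f) = iota f `&` \pi_(fquot R I) (cst 1 : X -> R)].
Proof.
exists (G * (nat -> G))%type, (negligible_ideal trunc).
exists (representation R trunc); split.
- exact: representation_inj.
- exact: representation_sigma_continuous.
- by split=> f g; [exact: representationD | exact: representationI
    | exact: representationU].
- exact: representation_trunc.
Qed.
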